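(* For every integer $n\ge 5$, all eigenvalues (in $\mathbb{C}$) of the discrete Laplacian $L\in\mathbb{R}^{n\times n}$ constructed by the Bramble--Hubbard finite-difference scheme are real and positive.
   Context: Let $n\ge 5$ and $h=1/(n+1)$. The Bramble--Hubbard discrete Laplacian is the matrix $L=\frac{1}{12h^2}M\in\mathbb{R}^{n\times n}$, where $M$ has the following entries. - First row: $M_{1,1}=24$, $M_{1,2}=-12$, and $M_{1,j}=0$ for $j\ge 3$. - Rows $2\le i\le n-1$: $M_{i,j}=30$ if $j=i$, $M_{i,j}=-16$ if $|i-j|=1$, $M_{i,j}=1$ if $|i-j|=2$, and $M_{i,j}=0$ otherwise (for $1\le j\le n$). - Last row: $M_{n,n}=24$, $M_{n,n-1}=-12$, and $M_{n,j}=0$ for $j\le n-2$. (This is the fourth-order central difference discretization of $-\mathrm{d}^2/\mathrm{d}x^2$ on $(0,1)$ with homogeneous Dirichlet boundary conditions on the uniform grid $x_i=ih$, with the second-order central difference used at the two near-boundary points.) *)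

(* Defs.v *)
From mathcomp Require Import all_boot all_order all_algebra.
From mathcomp Require Import reals complex.

Set Implicit Arguments.
Unset Strict Implicit.
Unset Printing Implicit Defensive.

Import Order.TTheory GRing.Theory Num.Theory.

Local Open Scope ring_scope.

(* Rows and columns are numbered from 0, so the near-boundary rows are 0 and
   n.-1; `|i - j|%N is the distance between the natural numbers i and j. *)
Definition bh_stencil (R : realType) (n : nat) : 'M[R]_n :=
  \matrix_(i < n, j < n)
    if i == 0%N :> nat then
      if j == 0%N :> nat then 24
      else if j == 1%N :> nat then - 12
      else 0
    else if i == n.-1 :> nat then
      if j == n.-1 :> nat then 24
      else if j == n.-2 :> nat then - 12
      else 0
    else
      if j == i then 30
      else if `|i - j|%N == 1%N then - 16
      else if `|i - j|%N == 2%N then 1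
      else 0.

Definition bh_mesh (R : realType) (n : nat) : R := 1 / n.+1%:R.

Definition bh_laplacian (R : realType) (n : nat) : 'M[R]_n :=
  (1 / (12 * bh_mesh R n ^+ 2)) *: bh_stencil R n.

(* Embedding in R[i] makes the eigenvalues range over all complex numbers.
   eigenvalue of mxalgebra refers to row eigenvectors; the spectrum is the same
   as for column eigenvectors. *)
Definition bh_laplacian_complex (R : realType) (n : nat) : 'M[R[i]]_n :=
  map_mx (real_complex R) (bh_laplacian R n).

(* Main.v *)
Require Import Defs.
From mathcomp Require Import all_boot all_order all_algebra.
From mathcomp Require Import reals complex.
From mathcomp Require Import zify ring.

Set Implicit Arguments.
Unset Strict Implicit.

Import Order.TTheory GRing.Theory Num.Theory.

Local Open Scope ring_scope.
Local Open Scope sesquilinear_scope.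

(** The interior rows of the stencil matrix [M] are those of [12 T + T ^+ 2] with
    [T = tridiag (-1, 2, -1)], and its two boundary rows are those of [12 T].
    With [P] the diagonal projection onto the interior indices this says
    [M = 12 T + P T^2 = (12 + P T) T].  The matrix [M] is not symmetric, but [T]
    is invertible and conjugating by [T] moves the right factor to the left:
    [T M T^-1 = T (12 + P T) = 12 T + T P T], which is symmetric.  It is also
    positive definite: [T = D D^T], for the matrix [D] of first differences,
    and [P = P P^T], so that
    [w (12 T + T P T) w^* = 12 |w D|^2 + |w T P|^2],
    where [w D = 0] forces [w = 0].  Hence the eigenvalues of [M] are those of
    a positive definite matrix, and the discrete Laplacian is a positive
    multiple of [M].  The argument rests on [bh_stencil_factor]
    for the factorization, [eigenvalue_mulmxC] for the conjugation, and
    [eigenvalue_posdef_gt0] with [secdiff_posdef] and [conj_stencil_posdef]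
    for positivity. *)

(** * Eigenvalues of positive definite matrices *)

Definition posdefmx (C : numClosedFieldType) (n : nat) (A : 'M[C]_n) :=
  forall w : 'rV_n, w != 0 -> 0 < dotmx (w *m A) w.

Lemma eigenvalue_posdef_gt0 (C : numClosedFieldType) (n : nat) (A : 'M[C]_n)
    (lambda : C) :
  posdefmx A -> eigenvalue A lambda -> 0 < lambda.
Proof.
move=> posA /eigenvalueP[w wA w_neq0].
have := posA w w_neq0; rewrite wA linearZl_LR /= pmulr_lgt0 //.
by rewrite dnorm_gt0.
Qed.

Lemma posdefmx_unit (C : numClosedFieldType) (n : nat) (A : 'M[C]_n) :
  posdefmx A -> A \in unitmx.
Proof.
move=> posA; rewrite -row_free_unit -kermx_eq0; apply/negPn/negP => kerA.
have /(eigenvalue_posdef_gt0 posA) : eigenvalue A 0.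
  by rewrite /eigenvalue /eigenspace raddf0 subr0.
by rewrite ltxx.
Qed.

(** Conjugation preserves the spectrum, and [B A] is the conjugate [B (A B) B^-1]. *)
Lemma eigenvalue_mulmxC (F : fieldType) (n : nat) (A B : 'M[F]_n) (lambda : F) :
  B \in unitmx -> eigenvalue (A *m B) lambda -> eigenvalue (B *m A) lambda.
Proof.
move=> uB /eigenvalueP[v vAB v_neq0]; apply/eigenvalueP.
exists (v *m invmx B); last first.
  apply: contraNneq v_neq0 => vB0.
  by rewrite -(mulmxKV uB v) vB0 mul0mx.
by rewrite mulmxA mulmxKV // -[v *m A](mulmxK uB) -(mulmxA v) vAB scalemxAl.
Qed.

Lemma eigenvalue_scale (F : fieldType) (n : nat) (A : 'M[F]_n) (c lambda : F) :
  c != 0 -> eigenvalue (c *: A) lambda -> eigenvalue A (c^-1 * lambda).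
Proof.
move=> c_neq0 /eigenvalueP[v vA v_neq0]; apply/eigenvalueP; exists v => //.
by rewrite -scalerA -vA -scalemxAr scalerA mulVf // scale1r.
Qed.

Lemma dotmx_gram (C : numClosedFieldType) (n p : nat) (G : 'M[C]_(n, p))
    (w : 'rV_n) :
  dotmx (w *m (G *m G^t*)) w = dotmx (w *m G) (w *m G).
Proof. by rewrite !dotmxE trmx_mul map_mxM !mulmxA. Qed.

(** * First and second differences with Dirichlet boundary conditions *)

Lemma sum_eq_nat (F : pzRingType) (n m : nat) (f : nat -> F) :
  \sum_(k < n) (k == m :> nat)%:R * f k = if (m < n)%N then f m else 0.
Proof.
case: ifP => [m_lt_n | m_ge_n].
  rewrite (bigD1 (Ordinal m_lt_n)) //= eqxx mul1r big1 ?addr0 // => k k_neq.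
  by rewrite -[m]/(val (Ordinal m_lt_n)) val_eqE (negPf k_neq) mul0r.
rewrite big1 // => k _; have /negPf-> : (k != m :> nat); last by rewrite mul0r.
by apply: contraFneq m_ge_n => <-.
Qed.

(** Row vectors are differenced with zero values on both sides, so [n] values
    have [n.+1] differences. *)
Definition diffmx (F : comPzRingType) (n : nat) : 'M[F]_(n, n.+1) :=
  \matrix_(i, k) ((k == i :> nat)%:R - (k == i.+1 :> nat)%:R).

Definition secdiffmx (F : comPzRingType) (n : nat) : 'M[F]_n :=
  diffmx F n *m (diffmx F n)^T.

(** Natural number arguments let row indices be shifted by one without bounds. *)
Definition secdiff (F : comPzRingType) (i j : nat) : F :=
  (i == j)%:R *+ 2 - (i == j.+1)%:R - (i.+1 == j)%:R.

Definition interiormx (F : comPzRingType) (n : nat) : 'M[F]_n :=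
  diag_mx (\row_(i < n) ((i != 0 :> nat) && (i != n.-1 :> nat))%:R).

Lemma secdiffmxE (F : comPzRingType) (n : nat) (i j : 'I_n) :
  secdiffmx F n i j = secdiff F i j.
Proof.
rewrite mxE.
under eq_bigr => k _ do rewrite !mxE mulrBl.
rewrite sumrB (sum_eq_nat _ _ (fun k => (k == j)%:R - (k == j.+1)%:R)).
rewrite (sum_eq_nat _ _ (fun k => (k == j)%:R - (k == j.+1)%:R)).
by rewrite ltnS ltnW // ltnS ltn_ord eqSS /secdiff; ring.
Qed.

(** Summation recovers a vector from its differences: the upper triangular
    matrix of ones is a right inverse of [diffmx]. *)
Lemma diffmx_row_free (F : fieldType) (n : nat) : row_free (diffmx F n).
Proof.
apply/row_freeP; exists (\matrix_(k, j) (k <= j)%N%:R).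
apply/matrixP => i j; rewrite !mxE.
under eq_bigr => k _ do rewrite !mxE mulrBl.
rewrite sumrB (sum_eq_nat _ _ (fun k => (k <= j)%N%:R)).
rewrite (sum_eq_nat _ _ (fun k => (k <= j)%N%:R)).
rewrite ltnS ltnW // ltnS ltn_ord -val_eqE /=.
by case: ltngtP => _; rewrite ?subrr ?subr0.
Qed.

Lemma map_secdiffmx (F F' : comPzRingType) (f : {rmorphism F -> F'}) (n : nat) :
  map_mx f (secdiffmx F n) = secdiffmx F' n.
Proof.
rewrite map_mxM -map_trmx; congr (_ *m _^T);
by apply/matrixP => i k; rewrite !mxE rmorphB !rmorph_nat.
Qed.

Lemma map_interiormx (F F' : comPzRingType) (f : {rmorphism F -> F'}) (n : nat) :
  map_mx f (interiormx F n) = interiormx F' n.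
Proof.
by rewrite map_diag_mx; congr diag_mx; apply/rowP => i; rewrite !mxE rmorph_nat.
Qed.

Lemma conj_diffmx (C : numClosedFieldType) (n : nat) :
  (diffmx C n)^t* = (diffmx C n)^T.
Proof. by apply/matrixP => i k; rewrite !mxE rmorphB !rmorph_nat. Qed.

Lemma conj_secdiffmx (C : numClosedFieldType) (n : nat) :
  (secdiffmx C n)^t* = secdiffmx C n.
Proof. by rewrite /secdiffmx -conj_diffmx trmx_mul map_mxM trmxCK. Qed.

Lemma conj_interiormx (C : numClosedFieldType) (n : nat) :
  (interiormx C n)^t* = interiormx C n.
Proof. by rewrite tr_diag_mx map_interiormx. Qed.

Lemma interiormx_idem (F : comPzRingType) (n : nat) :
  interiormx F n *m interiormx F n = interiormx F n.
Proof.
rewrite mulmx_diag; congr diag_mx; apply/rowP => i.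
by rewrite !mxE -natrM mulnb andbb.
Qed.

(** The quadratic form is the squared norm of the first differences. *)
Lemma secdiff_posdef (C : numClosedFieldType) (n : nat) :
  posdefmx (secdiffmx C n).
Proof.
move=> w w_neq0; rewrite /secdiffmx -conj_diffmx dotmx_gram dnorm_gt0.
by rewrite mulmx_free_eq0 ?diffmx_row_free.
Qed.

(** * The Bramble--Hubbard stencil *)

(** An interior row [i] has both neighbours [i.-1] and [i.+1] inside the matrix,
    so the second difference of the rows keeps all three terms; the product is
    there the pentadiagonal stencil [1, -4, 6, -4, 1], except that the columns
    cut it off at the ends. *)
Lemma mul_secdiffmxE (F : comPzRingType) (n : nat) (i j : 'I_n) :
  i != 0%N :> nat -> i != n.-1 :> nat ->
  (secdiffmx F n *m secdiffmx F n) i j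
  = secdiff F i j *+ 2 - secdiff F i.-1 j - secdiff F i.+1 j.
Proof.
move=> i_gt0 i_lt; rewrite mxE.
have expand (k : 'I_n) : secdiffmx F n i k * secdiffmx F n k j =
    (k == i :> nat)%:R * (secdiff F k j *+ 2)
    - (k == i.-1 :> nat)%:R * secdiff F k j
    - (k == i.+1 :> nat)%:R * secdiff F k j.
  rewrite !secdiffmxE {1}/secdiff [i == k :> nat]eq_sym [i.+1 == k]eq_sym.
  have -> : (i == k.+1 :> nat) = (k == i.-1 :> nat) by lia.
  by ring.
under eq_bigr => k _ do rewrite expand.
rewrite !sumrB (sum_eq_nat _ _ (fun k => secdiff F k j *+ 2)).
rewrite !(sum_eq_nat _ _ (fun k => secdiff F k j)) ltn_ord.
have i_lt_n := ltn_ord i.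
by rewrite !ifT //; lia.
Qed.

(** In the interior, [12 (-1, 2, -1) + (1, -4, 6, -4, 1)] is the fourth-order
    stencil [(1, -16, 30, -16, 1)]; in a boundary row the projection kills the
    second summand and leaves [12 (-1, 2, -1)]. *)
Lemma bh_stencil_factor (R : realType) (n : nat) :
  bh_stencil R n
  = (12%:M + interiormx R n *m secdiffmx R n) *m secdiffmx R n.
Proof.
apply/matrixP => i j.
rewrite mulmxDl mul_scalar_mx -mulmxA mul_diag_mx mxE.
rewrite [RHS]mxE [X in _ = X + _]mxE [X in _ = _ + X]mxE secdiffmxE.
rewrite [X in _ = _ + X * _]mxE.
have [i_lt_n j_lt_n] := (ltn_ord i, ltn_ord j).
have [i0 | i_neq0] := eqVneq (i : nat) 0%N.
  rewrite mul0r addr0 i0 /secdiff.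
  by do !case: eqP => ? /=; try lia; ring.
have [in1 | i_neqn] := eqVneq (i : nat) n.-1.
  rewrite mul0r addr0 in1 /secdiff.
  by do !case: eqP => ? /=; try lia; ring.
rewrite mul1r mul_secdiffmxE // /secdiff -[j == i]val_eqE /=.
by do !case: eqP => ? /=; try lia; ring.
Qed.

(** As [P] is an orthogonal projection, [T (12 + P T)] is [12 T] plus the Gram
    matrix of [T P], hence positive definite plus positive semidefinite. *)
Lemma conj_stencil_posdef (C : numClosedFieldType) (n : nat) :
  posdefmx (secdiffmx C n *m (12%:M + interiormx C n *m secdiffmx C n)).
Proof.
set T := secdiffmx C n; set P := interiormx C n.
have -> : T *m (12%:M + P *m T) = 12 *: T + (T *m P) *m (T *m P)^t*.
  rewrite trmx_mul map_mxM conj_secdiffmx conj_interiormx -/T -/P.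
  rewrite mulmxDr mul_mx_scalar (mulmxA T P T) (mulmxA (T *m P) P T).
  by rewrite -(mulmxA T P P) interiormx_idem.
move=> w w_neq0; rewrite mulmxDr linearDl /= dotmx_gram.
rewrite ltr_wpDr ?dnorm_ge0 // -scalemxAr linearZl_LR /= mulr_gt0 ?ltr0n //.
exact: secdiff_posdef.
Qed.

Theorem theorem1 (R : realType) (n : nat) (hn : (5 <= n)%N) (lambda : R[i])
    (hlambda : eigenvalue (bh_laplacian_complex R n) lambda) :
  complex.Im lambda = 0 /\ 0 < complex.Re lambda.
Proof.
suff: 0 < lambda by rewrite ltcE => /andP[/eqP].
pose c : R := 1 / (12 * bh_mesh R n ^+ 2).
have c_gt0 : 0 < (real_complex R c).
  by rewrite ltcR !(divr_gt0, mulr_gt0, exprn_gt0, ltr0n, ltr01).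
move: hlambda; rewrite /bh_laplacian_complex /bh_laplacian bh_stencil_factor.
rewrite map_mxZ map_mxM map_mxD map_mxM map_scalar_mx.
rewrite !map_secdiffmx map_interiormx rmorph_nat.
move=> /(eigenvalue_scale (lt0r_neq0 c_gt0)).
move=> /(eigenvalue_mulmxC (posdefmx_unit (@secdiff_posdef _ n))).
move=> /(eigenvalue_posdef_gt0 (@conj_stencil_posdef _ n)).
by rewrite pmulr_rgt0 ?invr_gt0.
Qed.
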